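(* Any solution $\tilde{\mathbf e}=(\tilde e_1,\dots,\tilde e_m)$ of the problem of minimizing, subject to the assumptions (i)–(vi) of the context (of which only (ii) and (vi) constrain $\mathbf e$), either $$l(\mathbf e)=\int g(\mathbf x)\log\left[\frac{g(\mathbf x)}{\sum_{j=1}^m(\mathcal N_he_j)(\mathbf x)}\right]d\mathbf x+\int\left[\sum_{j=1}^m e_j(\mathbf x)\right]d\mathbf x$$ or its discrete version $$l_{\mathrm{discrete}}(\mathbf e)=-\frac1n\sum_{i=1}^n\log\sum_{j=1}^m(\mathcal N_he_j)(\mathbf x_i)+\int\sum_{j=1}^m e_j(\mathbf x)\,d\mathbf x$$ satisfies $$\int\sum_{j=1}^m\tilde e_j(\mathbf x)\,d\mathbf x=1 .$$
   Context: Setting. $\Omega=[a,b]^r\subset\mathbb R^r$ with $a<b$; $g$ is a probability density on $\mathbb R^r$ (the target) with support in the interior of $\Omega$; $h\in\mathbb R$ is a given bandwidth; $s_h\in L^1(\mathbb R\times\mathbb R)$ is nonnegative with support in $[a,b]\times[a,b]$. In the discrete version, $\mathbf x_1,\dots,\mathbf x_n$ is a random sample of size $n$, whose empirical distribution replaces $g(\mathbf x)\,d\mathbf x$. Assumptions. (i) The number $m$ of mixing components in $g$ is fixed, and there exist nonnegative functions $e_1,\dots,e_m$ with $g(\mathbf x)=\sum_{j=1}^m e_j(\mathbf x)$. (ii) For each $1\le j\le m$, $e_j(\mathbf x)=\theta_j\prod_{k=1}^r e_{j,k}(x_k)$, where $\theta_j>0$ and each $e_{j,k}\in L^1(\mathbb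 R)$ is positive with support in $[a,b]$. (iii) $\int s_h(v,u)\,du=\int s_h(u,z)\,du=1$ for $v,z\in[a,b]$. (iv) There are positive numbers $M_1(h)$ and $M_2$ with $M_1(h)\le s_h(v,z)\le M_2$ for all $v,z\in[a,b]$. (v) $s_h$ has continuous first-order partial derivatives on $(a,b)\times(a,b)$, both bounded there in absolute value by a constant $B$. (vi) With $f_j(\mathbf x)=e_j(\mathbf x)/\int e_j(\mathbf z)\,d\mathbf z$, one has $f_j(\mathbf x)\ge(M_1(h))^r$ for all $\mathbf x\in\Omega$ and each $j$. Candidates. The $m$-tuple $\mathbf e=(e_1,\dots,e_m)$ is the unknown. The only assumptions that impose constraints on a candidate $\mathbf e$ are (ii) and (vi); in particular it is not required that $\sum_je_j$ be a density. Smoothing. $\tilde s_h(\mathbf x,\mathbf u)=\prod_{k=1}^r s_h(x_k,u_k)$; $(S_h^*f)(\mathbf x)=\int\tilde s_h(\mathbf u,\mathbf x)f(\mathbf u)\,d\mathbf u$; $(\mathcal N_hf)(\mathbf x)=\exp[(S_h^*\log f)(\mathbf x)]$ for $\mathbf x\in\Omega$ and $0$ elsewhere (integrals against $\tilde s_h$ are effectively over $\Omega$). *)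

(* Defs.v *)
From HB Require Import structures.
From mathcomp Require Import all_boot all_order all_algebra.
From mathcomp Require Import all_classical all_reals all_analysis.

Set Implicit Arguments.
Unset Strict Implicit.
Unset Printing Implicit Defensive.

Import Order.TTheory GRing.Theory Num.Theory.
Import numFieldNormedType.Exports.

Local Open Scope classical_set_scope.
Local Open Scope ring_scope.

(* R^r is r.-tuple R, with the product sigma-algebra of the library; the library
   has no Lebesgue measure on it, so it is built by recursion on r as the image
   of (lebesgue_measure \x lebesgue_tuple r) under (t, x) |-> t :: x.
   Lemma lebesgue_tuple_box below computes it on boxes, which characterizes it. *)
Section lebesgue_tuple_step.
Context (R : realType) (n : nat).
Variable mu : {sigma_finite_measure set (n.-tuple R) -> \bar R}.
Local Open Scope ereal_scope.

Definition tuple_cons (p : measurableTypeR R * n.-tuple R) : n.+1.-tuple R :=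
  [tuple of p.1 :: p.2].

Lemma measurable_tuple_cons :
  measurable_fun [set: measurableTypeR R * n.-tuple R] tuple_cons.
Proof. exact: (@measurable_cons _ _ _ R). Qed.

Definition lebesgue_cons : set (n.+1.-tuple R) -> \bar R :=
  pushforward (@lebesgue_measure R \x mu) tuple_cons.

Let lebesgue_cons0 : lebesgue_cons set0 = 0.
Proof. by rewrite /lebesgue_cons /pushforward preimage_set0 measure0. Qed.

Let lebesgue_cons_ge0 A : 0 <= lebesgue_cons A.
Proof. by rewrite /lebesgue_cons /pushforward measure_ge0. Qed.

Let lebesgue_cons_sigma_additive : semi_sigma_additive lebesgue_cons.
Proof.
move=> F mF tF mUF; rewrite /lebesgue_cons /pushforward preimage_bigcup.
have mpre A : measurable A -> measurable (tuple_cons @^-1` A).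
  by move=> mA; rewrite -[X in measurable X]setTI; exact: measurable_tuple_cons.
apply: measure_semi_sigma_additive.
- by move=> k; exact: mpre.
- apply/trivIsetP => /= i j _ _ ij; rewrite -preimage_setI.
  by move/trivIsetP : tF => /(_ _ _ _ _ ij) ->//; rewrite preimage_set0.
- by rewrite -preimage_bigcup; exact: mpre.
Qed.

HB.instance Definition _ := isMeasure.Build _ _ _ lebesgue_cons
  lebesgue_cons0 lebesgue_cons_ge0 lebesgue_cons_sigma_additive.

Definition tuple_uncons (x : n.+1.-tuple R) : measurableTypeR R * n.-tuple R :=
  (thead x, [tuple of behead x]).

Lemma measurable_tuple_uncons : measurable_fun setT tuple_uncons.
Proof.
apply/measurable_fun_pair; last exact: measurable_behead.
exact: measurable_tnth.
Qed.

Lemma tuple_consK : cancel tuple_cons tuple_uncons.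
Proof.
by move=> [t x]; rewrite /tuple_uncons /= theadE; congr pair; apply: val_inj.
Qed.

Lemma tuple_unconsK : cancel tuple_uncons tuple_cons.
Proof. by move=> x; rewrite [RHS]tuple_eta; apply: val_inj. Qed.

Let lebesgue_cons_sigma_finite : sigma_finite setT lebesgue_cons.
Proof.
have /sigma_finiteP[F [TF ndF Foo]] := sigma_finiteT (@lebesgue_measure R).
have /sigma_finiteP[G [TG ndG Goo]] := sigma_finiteT mu.
exists (fun k => tuple_uncons @^-1` (F k `*` G k)).
  rewrite -preimage_bigcup (_ : \bigcup_k _ = setT) ?preimage_setT//.
  apply/seteqP; split => // -[t x] _.
  have [i _ Fit] : (\bigcup_i F i) t by rewrite -TF.
  have [j _ Gjx] : (\bigcup_j G j) x by rewrite -TG.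
  exists (maxn i j) => //; split => /=.
    by move: Fit; exact/subsetPset/ndF/leq_maxl.
  by move: Gjx; exact/subsetPset/ndG/leq_maxr.
move=> k; have [mF Fk] := Foo k; have [mG Gk] := Goo k; split.
  rewrite -[X in measurable X]setTI; apply: measurable_tuple_uncons => //.
  exact: measurableX.
rewrite /lebesgue_cons /pushforward -comp_preimage.
rewrite (_ : tuple_uncons \o tuple_cons = idfun); last first.
  by apply/funext => p /=; rewrite tuple_consK.
by rewrite /= product_measure1E// lte_mul_pinfty// ge0_fin_numE.
Qed.

HB.instance Definition _ := Measure_isSigmaFinite.Build _ _ _ lebesgue_cons
  lebesgue_cons_sigma_finite.

End lebesgue_tuple_step.

Fixpoint lebesgue_tuple (R : realType) (n : nat) :
    {sigma_finite_measure set (n.-tuple R) -> \bar R} :=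
  match n with
  | 0 => [the {sigma_finite_measure set (0.-tuple R) -> \bar R} of
            dirac [tuple]]
  | k.+1 => [the {sigma_finite_measure set (k.+1.-tuple R) -> \bar R} of
            lebesgue_cons (lebesgue_tuple R k)]
  end.

Lemma measurable_box (R : realType) (n : nat) (A : 'I_n -> set R) :
  (forall k, measurable (A k)) ->
  measurable [set x : n.-tuple R | forall k, A k (tnth x k)].
Proof.
move=> mA; rewrite (_ : [set _ | _] =
    \bigcap_(k in [set: 'I_n]) ((fun x : n.-tuple R => tnth x k) @^-1` A k)).
  apply: fin_bigcap_measurable => // k _.
  by rewrite -[X in measurable X]setTI; exact: measurable_tnth.
by apply/seteqP; split => x /= xA k => [_|]; exact: xA.
Qed.

Lemma lebesgue_tuple_box (R : realType) (n : nat) (A : 'I_n -> set R) :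
  (forall k, measurable (A k)) ->
  lebesgue_tuple R n [set x | forall k, A k (tnth x k)] =
  (\prod_(k < n) lebesgue_measure (A k))%E.
Proof.
elim: n A => [|n IH] A mA.
  rewrite big_ord0 /= diracE (_ : _ \in _ = true)//.
  by apply/mem_set => -[].
rewrite big_ord_recl /= -(IH (fun k => A (lift ord0 k)))//.
rewrite /lebesgue_cons /pushforward -product_measure1E; last 2 first.
- exact: mA.
- exact: (measurable_box (fun k => mA (lift ord0 k))).
congr (product_measure1 _ _ _); apply/seteqP; split => -[t x] /=.
  move=> H; split; first by have := H ord0; rewrite tnth0.
  by move=> k; have := H (lift ord0 k); rewrite tnthS.
by move=> [At Ax] k; case: (unliftP ord0 k) => [j|] ->;
  [rewrite tnthS|rewrite tnth0].
Qed.

Section setting.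
Context (R : realType).
Local Open Scope ereal_scope.

Definition cube (a b : R) (r : nat) : set (r.-tuple R) :=
  [set x | forall k : 'I_r, (a <= tnth x k <= b)%R].

(* n.-tuple carries no topology: the topological support of g and the interior
   of the cube are taken in 'rV[R]_r. *)
Definition tuple_row (r : nat) (x : r.-tuple R) : 'rV[R]_r :=
  (\row_k tnth x k)%R.

Definition topological_support (r : nat) (g : r.-tuple R -> R) :
    set 'rV[R]_r :=
  closure (@tuple_row r @` [set x | g x != 0%R]).

Definition target_density (a b : R) (r : nat) (g : r.-tuple R -> R) : Prop :=
  [/\ measurable_fun setT g,
      forall x, (0 <= g x)%R,
      \int[lebesgue_tuple R r]_x (g x)%:E = 1 &
      topological_support g `<=` interior (@tuple_row r @` @cube a b r)].

(* s v u is s_h(v, u) at the given bandwidth h; M1 is M_1(h). *)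
Definition smoothing_kernel (a b : R) (s : R -> R -> R) (M1 M2 B : R) : Prop :=
  [/\ (@lebesgue_measure R \x @lebesgue_measure R).-integrable setT
        (fun p => (s p.1 p.2)%:E),
      forall v u, (0 <= s v u)%R &
      forall v u, s v u != 0%R -> (a <= v <= b)%R /\ (a <= u <= b)%R] /\
  [/\ forall v, (a <= v <= b)%R -> \int[lebesgue_measure]_u (s v u)%:E = 1,
      forall z, (a <= z <= b)%R -> \int[lebesgue_measure]_u (s u z)%:E = 1,
      (0 < M1)%R /\ (0 < M2)%R &
      forall v z, (a <= v <= b)%R -> (a <= z <= b)%R -> (M1 <= s v z <= M2)%R] /\
  let D := `]a, b[%classic `*` `]a, b[%classic in
  let d1 (p : R * R) := derive1 (fun v => s v p.2) p.1 in
  let d2 (p : R * R) := derive1 (fun u => s p.1 u) p.2 in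
  [/\ forall p, D p -> derivable (fun v => s v p.2) p.1 1%R /\
                       derivable (fun u => s p.1 u) p.2 1%R,
      {within D, continuous d1},
      {within D, continuous d2} &
      forall p, D p -> (`|d1 p| <= B)%R /\ (`|d2 p| <= B)%R].

Definition product_component (a b : R) (r : nat) (e : r.-tuple R -> R) : Prop :=
  exists (theta : R) (ek : 'I_r -> R -> R),
    [/\ (0 < theta)%R,
        forall k, [/\ lebesgue_measure.-integrable setT (EFin \o ek k),
                      forall t, (a <= t <= b)%R -> (0 < ek k t)%R &
                      forall t, ~ (a <= t <= b)%R -> ek k t = 0%R] &
        forall x, e x = (theta * \prod_(k < r) ek k (tnth x k))%R].

Definition normalized (r : nat) (e : r.-tuple R -> R) (x : r.-tuple R) :
    \bar R :=
  (e x)%:E / \int[lebesgue_tuple R r]_z (e z)%:E.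

Definition candidate (a b M1 : R) (r m : nat) (e : 'I_m -> r.-tuple R -> R) :
    Prop :=
  forall j, product_component a b (e j) /\
    forall x, cube a b x -> (M1 ^+ r)%:E <= normalized (e j) x.

Definition product_kernel (s : R -> R -> R) (r : nat) (x u : r.-tuple R) : R :=
  (\prod_(k < r) s (tnth x k) (tnth u k))%R.

Definition smooth_adj (s : R -> R -> R) (r : nat) (f : r.-tuple R -> \bar R)
    (x : r.-tuple R) : \bar R :=
  \int[lebesgue_tuple R r]_u ((product_kernel s u x)%:E * f u).

(* lne 0 = -oo and 0 * -oo = 0, so that for a component f vanishing outside the
   cube only u in the cube contributes to the integral in smooth_adj. *)
Definition nonlin_smooth (a b : R) (s : R -> R -> R) (r : nat)
    (f : r.-tuple R -> R) (x : r.-tuple R) : \bar R :=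
  if x \in @cube a b r then expeR (smooth_adj s (fun u => lne (f u)%:E) x)
  else 0.

Definition objective (a b : R) (s : R -> R -> R) (r m : nat)
    (g : r.-tuple R -> R) (e : 'I_m -> r.-tuple R -> R) : \bar R :=
  \int[lebesgue_tuple R r]_x
    ((g x)%:E * lne ((g x)%:E / \sum_(j < m) nonlin_smooth a b s (e j) x)) +
  \int[lebesgue_tuple R r]_x (\sum_(j < m) e j x)%:E.

Definition objective_discrete (a b : R) (s : R -> R -> R) (r m n : nat)
    (X : 'I_n -> r.-tuple R) (e : 'I_m -> r.-tuple R -> R) : \bar R :=
  - ((n%:R^-1)%:E *
     \sum_(i < n) lne (\sum_(j < m) nonlin_smooth a b s (e j) (X i))) +
  \int[lebesgue_tuple R r]_x (\sum_(j < m) e j x)%:E.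

(* The minimum is required to be finite: when g log g is not integrable the
   objective is identically +oo and minimizing it is meaningless. *)
Definition solution (T : Type) (C : set T) (l : T -> \bar R) (e : T) : Prop :=
  [/\ C e, l e \is a fin_num & forall e', C e' -> l e <= l e'].

End setting.

(* Main.v *)
Require Import Defs.
From mathcomp Require Import all_boot all_order all_algebra.
From mathcomp Require Import all_classical all_reals all_analysis.
From mathcomp Require Import measurable_realfun lra.

Import Order.TTheory GRing.Theory Num.Theory.
Import numFieldNormedType.Exports.

Local Open Scope classical_set_scope.
Local Open Scope ring_scope.

(* Multiplying a candidate e by c > 0 preserves all constraints.  Since the
   kernel integrates to 1 in its first variable on the cube, N_h (c e_j) =
   c N_h e_j there, so both objectives satisfy, with I the total mass of e,
   l(c e) = l(e) - ln c + (c - 1) I.  At a minimizer (c - 1) I >= ln c for all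
   c > 0, which forces I = 1. *)

(** * Logarithm, exponential and inverse on the extended reals *)

Section extended_reals.
Context (R : realType).
Local Open Scope ereal_scope.

(** At [y = 0] both sides are [-oo]: [lne 0 = -oo] absorbs the finite [ln c]. *)
Lemma lneMl (c : R) (y : \bar R) : (0 < c)%R -> 0 <= y ->
  lne (c%:E * y) = (ln c)%:E + lne y.
Proof.
move=> c0; rewrite le_eqVlt => /predU1P[<-|y0].
  by rewrite mule0 le0_lneNy// addeNy.
by rewrite lneM ?lne_EFin// in_itv/= leey ?lte_fin ?c0 ?y0.
Qed.

(** The outer factor [t] settles [t = 0], where [ln 0 = 0] but [lne 0 = -oo]. For [t > 0] and
    [y = 0] the convention [0^-1 = +oo] makes both sides [+oo]. *)
Lemma mule_lne_div (t : R) (y : \bar R) : (0 <= t)%R -> 0 <= y ->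
  t%:E * lne (t%:E / y) = t%:E * ((ln t)%:E - lne y).
Proof.
rewrite le_eqVlt => /predU1P[<-|t0]; first by rewrite !mul0e.
rewrite le_eqVlt => /predU1P[<-|y0].
  by rewrite inve0 gt0_muley ?lte_fin//= lexx.
by rewrite lne_div ?lne_EFin// in_itv/= leey ?lte_fin ?t0 ?y0.
Qed.

(** The conventions [0^-1 = +oo], [+oo^-1 = 0] and [-oo^-1 = -oo] are all compatible with a positive
    factor. This lets a scalar cancel in [normalized]. *)
Lemma invepM (c : R) (y : \bar R) : (0 < c)%R ->
  (c%:E * y)^-1 = (c^-1)%:E * y^-1.
Proof.
move=> c0; case: y => [y| |].
- have [->|y0] := eqVneq y 0%R.
    by rewrite mule0 inve0 gt0_muley// lte_fin invr_gt0.
  by rewrite -EFinM !inver mulf_eq0 gt_eqF// (negbTE y0)/= -EFinM invfM.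
- by rewrite gt0_muley// invey mule0.
- by rewrite gt0_muleNy// inveNy gt0_muleNy// lte_fin invr_gt0.
Qed.

(** The infinite points add at most two measurable singletons to a preimage; the rest is the image
    under [EFin] of a measurable set of reals. *)
Lemma measurable_fun_ereal (phi : \bar R -> \bar R) :
  measurable_fun setT (phi \o EFin) -> measurable_fun setT phi.
Proof.
move=> mphi _ Y mY; rewrite setTI.
have minf (x : \bar R) : measurable ([set x] `&` phi @^-1` Y).
  have [Yx|nYx] := pselect ((phi @^-1` Y) x).
    by rewrite setIidl => // _ ->.
  by rewrite (_ : _ `&` _ = set0)//; apply/seteqP; split => // _ [->].
rewrite (_ : _ @^-1` _ = EFin @` ((phi \o EFin) @^-1` Y) `|`
    (([set +oo] `&` phi @^-1` Y) `|` ([set -oo] `&` phi @^-1` Y))).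
  apply: measurableU; last exact: measurableU.
  apply: measurable_image_EFin.
  by have := mphi measurableT _ mY; rewrite setTI.
apply/seteqP; split => [[x| |] /= Yx|x].
- by left; exists x.
- by right; left.
- by right; right.
- by case=> [[y /= Yy <-]|[[->]|[->]]].
Qed.

Lemma measurable_expeR : measurable_fun setT (@expeR R).
Proof.
apply: measurable_fun_ereal; apply/measurable_EFinP; exact: measurable_expR.
Qed.

Lemma measurable_lne : measurable_fun setT (@lne R).
Proof.
apply: measurable_fun_ereal.
apply: (measurable_fun_ifT (f := fun r : R => (r <= 0)%R)) => //.
  exact: measurable_fun_ler.
by apply/measurable_EFinP; exact: measurable_ln.
Qed.

End extended_reals.

(** * Additivity of the integral with one integrable summand *)

Section integral_lemmas.
Local Open Scope ereal_scope.

(** An integrable perturbation cannot destroy finiteness; this is meant for comparing the positive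
    and negative parts of two functions that differ by [f]. *)
Lemma ge0_integral_lty_le d (T : measurableType d) (R : realType)
    (mu : {measure set T -> \bar R}) (f : T -> R) (p q : T -> \bar R) :
  mu.-integrable setT (EFin \o f) ->
  measurable_fun setT p -> measurable_fun setT q ->
  (forall x, 0 <= p x) -> (forall x, 0 <= q x) ->
  (forall x, p x <= q x + `|(f x)%:E|) ->
  \int[mu]_x q x < +oo -> \int[mu]_x p x < +oo.
Proof.
move=> /integrableP[mf foo] mp mq p0 q0 pq qoo.
apply: (@le_lt_trans _ _ (\int[mu]_x (q x + `|(f x)%:E|))).
  apply: ge0_le_integral => //.
  by apply: emeasurable_funD => //; exact: measurableT_comp.
rewrite ge0_integralD//; first by rewrite lte_add_pinfty.
exact: measurableT_comp.
Qed.

(* The library's integralD needs both summands integrable.  Here the integral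
   of g may be infinite; when both its parts are, both sides are -oo. *)
Lemma integralD_integrable_measurable d (T : measurableType d) (R : realType)
    (mu : {measure set T -> \bar R}) (f : T -> R) (g : T -> \bar R) :
  mu.-integrable setT (EFin \o f) -> measurable_fun setT g ->
  \int[mu]_x ((f x)%:E + g x) = \int[mu]_x (f x)%:E + \int[mu]_x g x.
Proof.
move=> fi mg; have mf := measurable_int _ fi.
pose h x := (f x)%:E + g x.
have mh : measurable_fun setT h by exact: emeasurable_funD.
have ffin : \int[mu]_x (f x)%:E \is a fin_num.
  exact: integrable_fin_num.
have part_le (p q : T -> \bar R) := @ge0_integral_lty_le _ T R mu f p q fi.
have mgp := measurable_funepos mg; have mgn := measurable_funeneg mg.
have mhp := measurable_funepos mh; have mhn := measurable_funeneg mh.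
(* Adding [f] changes a positive or negative part by at most [|f|]; these bounds carry finiteness of
   the integrals between [g] and [h]. *)
have gn_le x : g^\- x <= h^\- x + `|(f x)%:E|.
  rewrite !funenegE /h; case: (g x) => [r| |] //=.
  - rewrite -!EFin_max lee_fin /Num.max.
    have := ler_norm (f x); have := normr_ge0 (f x).
    by do 2 case: ifPn; rewrite -?leNgt; lra.
  - by rewrite max_r ?leNye// adde_ge0// le_max lexx orbT.
have gp_le x : g^\+ x <= h^\+ x + `|(f x)%:E|.
  rewrite !funeposE /h; case: (g x) => [r| |] //=.
  - rewrite -!EFin_max lee_fin /Num.max.
    have := ler_norm (- f x); rewrite normrN; have := normr_ge0 (f x).
    by do 2 case: ifPn; rewrite -?leNgt; lra.
  - by rewrite max_r ?leNye// adde_ge0// le_max lexx orbT.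
have hn_le x : h^\- x <= g^\- x + `|(f x)%:E|.
  rewrite !funenegE /h; case: (g x) => [r| |] //=.
  - rewrite -!EFin_max lee_fin /Num.max.
    have := ler_norm (- f x); rewrite normrN; have := normr_ge0 (f x).
    by do 2 case: ifPn; rewrite -?leNgt; lra.
  - by rewrite max_r ?leNye// adde_ge0// le_max lexx orbT.
have [gnoo|gnoo] := ltP (\int[mu]_x g^\- x) +oo; last first.
  have hnoo : \int[mu]_x h^\- x = +oo.
    apply/eqP; rewrite -leye_eq leNgt; apply/negP => hnoo.
    by move: gnoo; rewrite leNgt (part_le _ _ mgn mhn _ _ gn_le hnoo).
  rewrite (integralE _ _ g) (integralE _ _ h) hnoo.
  by move: gnoo; rewrite leye_eq => /eqP ->; rewrite !addeNy.
have hnoo := part_le _ _ mhn mgn (funeneg_ge0 _) (funeneg_ge0 _) hn_le gnoo.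
have fin_neg u : \int[mu]_x u^\- x < +oo -> \int[mu]_x u^\- x \is a fin_num.
  by rewrite ge0_fin_numE// integral_ge0.
(* From here both negative parts have finite integrals. An infinite positive part therefore makes
   both sides [+oo]; otherwise [g] is integrable. *)
have [gpoo|gpoo] := ltP (\int[mu]_x g^\+ x) +oo; last first.
  have hpoo : \int[mu]_x h^\+ x = +oo.
    apply/eqP; rewrite -leye_eq leNgt; apply/negP => hpoo.
    by move: gpoo; rewrite leNgt (part_le _ _ mgp mhp _ _ gp_le hpoo).
  rewrite (integralE _ _ g) (integralE _ _ h) hpoo.
  move: gpoo; rewrite leye_eq => /eqP ->.
  have fin_oo (z : \bar R) : z \is a fin_num -> z + +oo = +oo by case: z.
  have oo_fin (z : \bar R) : z \is a fin_num -> +oo - z = +oo by case: z.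
  by rewrite !oo_fin ?fin_oo//; exact: fin_neg.
apply: integralD => //; apply/integrableP; split => //.
under eq_integral do rewrite -/((abse \o g) _) fune_abse.
by rewrite ge0_integralD// lte_add_pinfty.
Qed.

End integral_lemmas.

(** * Parametric integrals, and integrals of products of one-variable functions *)

Section parametric_integral.
Local Open Scope ereal_scope.

(** [H] may change sign, so the measurability part of Tonelli's theorem is applied to its positive
    and negative parts separately. *)
Lemma measurable_fun_integral1 d1 d2 (T1 : measurableType d1)
    (T2 : measurableType d2) (R : realType)
    (mu : {sigma_finite_measure set T1 -> \bar R}) (H : T1 * T2 -> \bar R) :
  measurable_fun setT H -> measurable_fun setT (fun y => \int[mu]_x H (x, y)).
Proof.
move=> mH; under eq_fun do rewrite integralE.
apply: emeasurable_funB.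
- have := measurable_fun_fubini_tonelli_G (m1 := mu) _
    (measurable_funepos mH) (funepos_ge0 _).
  by apply: eq_measurable_fun => y _; rewrite /fubini_G;
    apply: eq_integral => x _; rewrite !funeposE.
- have := measurable_fun_fubini_tonelli_G (m1 := mu) _
    (measurable_funeneg mH) (funeneg_ge0 _).
  by apply: eq_measurable_fun => y _; rewrite /fubini_G;
    apply: eq_integral => x _; rewrite !funenegE.
Qed.

(** Induction on [n]: the measure is the image of a product measure under [tuple_cons], so Tonelli
    splits off the first coordinate. For [n = 0] it is a point mass and both sides are 1. *)
Lemma integral_lebesgue_tuple_prod (R : realType) (n : nat)
    (f : 'I_n -> R -> R) :
  (forall k, measurable_fun setT (f k)) -> (forall k t, (0 <= f k t)%R) ->
  \int[lebesgue_tuple R n]_x (\prod_(k < n) f k (tnth x k))%:E =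
  \prod_(k < n) \int[lebesgue_measure]_t (f k t)%:E.
Proof.
elim: n f => [|n IH] f mf f0.
  under eq_integral do rewrite big_ord0.
  by rewrite big_ord0 integral_cst//= diracT mul1e.
have mprod p (g : 'I_p -> R -> R) : (forall k, measurable_fun setT (g k)) ->
    measurable_fun setT
      (fun x : p.-tuple R => (\prod_(k < p) g k (tnth x k))%:E).
  move=> mg; apply/measurable_EFinP; apply: measurable_prod => k _.
  by apply: measurableT_comp => //; exact: measurable_tnth.
rewrite ge0_integral_pushforward//=; last 3 first.
- exact: measurable_tuple_cons.
- exact: mprod.
- by move=> x _; rewrite lee_fin prodr_ge0.
rewrite preimage_setT.
under eq_integral => p _.
  rewrite big_ord_recl tnth0 EFinM.
  under eq_bigr do rewrite tnthS.
  over.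
rewrite /= fubini_tonelli1/=; last 2 first.
- apply: emeasurable_funM.
    apply/measurable_EFinP.
    exact: (measurableT_comp (mf ord0) measurable_fst).
  exact: (measurableT_comp (mprod _ (fun k => f (lift ord0 k)) _)
    measurable_snd).
- by move=> p; rewrite mule_ge0// lee_fin// prodr_ge0.
under eq_integral => t _.
  rewrite /fubini_F/= ge0_integralZl//; last 3 first.
  - exact: (mprod _ (fun k => f (lift ord0 k))).
  - by move=> x _; rewrite lee_fin prodr_ge0.
  - by rewrite lee_fin.
  rewrite (IH (fun k => f (lift ord0 k)))// muleC.
  over.
rewrite ge0_integralZl//; last 3 first.
- by apply/measurable_EFinP; exact: mf.
- by move=> t _; rewrite lee_fin.
- by apply: prode_ge0 => k _; apply: integral_ge0 => t _; rewrite lee_fin.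
by rewrite big_ord_recl muleC.
Qed.

End parametric_integral.

(** * The product kernel and the nonlinear smoothing operator *)

Section smoothing.
Context (R : realType) (a b : R) (s : R -> R -> R) (r : nat).
Hypothesis ms : measurable_fun setT
  (fun p : measurableTypeR R * measurableTypeR R => s p.1 p.2).
Hypothesis s0 : forall v u, 0 <= s v u.
Hypothesis s1 : forall z, a <= z <= b ->
  (\int[lebesgue_measure]_u (s u z)%:E = 1)%E.
Local Open Scope ereal_scope.

Lemma product_kernel_ge0 (u x : r.-tuple R) : (0 <= product_kernel s u x)%R.
Proof. exact: prodr_ge0. Qed.

Lemma measurable_product_kernel :
  measurable_fun setT
    (fun p : r.-tuple R * r.-tuple R => product_kernel s p.1 p.2).
Proof.
apply: measurable_prod => k _.
have mk : measurable_fun setT (fun p : r.-tuple R * r.-tuple R =>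
    (tnth p.1 k, tnth p.2 k)).
  apply/measurable_fun_pair => /=.
    exact: (measurableT_comp (measurable_tnth k) measurable_fst).
  exact: (measurableT_comp (measurable_tnth k) measurable_snd).
exact: (measurableT_comp ms mk).
Qed.

(** The integral factorizes over coordinates, and each factor is 1 by [s1] at a coordinate of [x],
    which lies in [[a, b]]. *)
Lemma integral_product_kernel (x : r.-tuple R) : cube a b x ->
  \int[lebesgue_tuple R r]_u (product_kernel s u x)%:E = 1.
Proof.
move=> xab; rewrite (integral_lebesgue_tuple_prod R r
    (fun k t => s t (tnth x k)))//.
  by rewrite big1// => k _; exact: s1.
by move=> k; exact: (measurable_fun_pair1 (tnth x k) ms).
Qed.

Lemma integrable_product_kernel (x : r.-tuple R) : cube a b x ->
  (lebesgue_tuple R r).-integrable setT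
    (EFin \o (fun u => product_kernel s u x)).
Proof.
move=> xab; apply/integrableP; split.
  apply/measurable_EFinP.
  exact: (measurable_fun_pair1 x measurable_product_kernel).
under eq_integral do rewrite gee0_abs ?lee_fin ?product_kernel_ge0//.
by rewrite integral_product_kernel// ltry.
Qed.

Lemma measurable_smooth_adj (f : r.-tuple R -> \bar R) :
  measurable_fun setT f -> measurable_fun setT (smooth_adj s f).
Proof.
move=> mf; apply: (measurable_fun_integral1 _ _ _ _ _ (lebesgue_tuple R r)
  (fun p => (product_kernel s p.1 p.2)%:E * f p.1)).
apply: emeasurable_funM; last exact: (measurableT_comp mf measurable_fst).
apply/measurable_EFinP; exact: measurable_product_kernel.
Qed.

Lemma measurable_cube : measurable (@cube R a b r).
Proof.
rewrite (_ : @cube R a b r =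
    [set x : r.-tuple R | forall k, `[a, b]%classic (tnth x k)]).
  exact: (@measurable_box _ _ (fun=> `[a, b]%classic)).
by apply/seteqP; split => x /= xab k; have := xab k; rewrite in_itv.
Qed.

Lemma nonlin_smooth_ge0 (e : r.-tuple R -> R) x : 0 <= nonlin_smooth a b s e x.
Proof. by rewrite /nonlin_smooth; case: ifP => // _; exact: expeR_ge0. Qed.

Lemma measurable_nonlin_smooth (e : r.-tuple R -> R) :
  measurable_fun setT e -> measurable_fun setT (nonlin_smooth a b s e).
Proof.
move=> me; apply: measurable_fun_ifT => //.
  apply: (measurable_fun_bool true); rewrite setTI.
  rewrite (_ : _ @^-1` _ = @cube R a b r); first exact: measurable_cube.
  by apply/seteqP; split => x /=; [exact: set_mem|exact: mem_set].
apply: measurableT_comp; first exact: measurable_expeR.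
apply: measurable_smooth_adj; apply: measurableT_comp.
  exact: measurable_lne.
exact/measurable_EFinP.
Qed.

(** On the cube the kernel has mass one, so the smoothed logarithm shifts by [ln c], which the
    exponential turns into the factor [c]. Outside it both sides vanish. *)
Lemma nonlin_smoothZ (c : R) (e : r.-tuple R -> R) x : (0 < c)%R ->
  (forall u, (0 <= e u)%R) -> measurable_fun setT e ->
  nonlin_smooth a b s (fun u => c * e u)%R x = c%:E * nonlin_smooth a b s e x.
Proof.
move=> c0 e0 me; rewrite /nonlin_smooth; case: ifPn => [|_]; last first.
  by rewrite mule0.
rewrite inE => xab.
rewrite (_ : smooth_adj _ _ _ =
    (ln c)%:E + smooth_adj s (fun u => lne (e u)%:E) x).
  by rewrite expeRD /= lnK// posrE.
rewrite /smooth_adj.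
have lnc_int : (lebesgue_tuple R r).-integrable setT
    (EFin \o (fun u => ln c * product_kernel s u x)%R).
  exact: (integrableZl measurableT (ln c) (integrable_product_kernel _ xab)).
(* The smoothed logarithm is not known to be finite here; only the [ln c] summand is integrable. *)
have := integralD_integrable_measurable _ _ _ _ _
  (fun u => (product_kernel s u x)%:E * lne (e u)%:E) lnc_int.
rewrite (integralZl measurableT (integrable_product_kernel _ xab)).
rewrite integral_product_kernel// mule1 => <-.
  apply: eq_integral => u _.
  by rewrite EFinM lneMl ?lee_fin// muleDr// EFinM [X in X + _]muleC.
apply: emeasurable_funM.
  apply/measurable_EFinP.
  exact: (measurable_fun_pair1 x measurable_product_kernel).
by apply: measurableT_comp; [exact: measurable_lne|exact/measurable_EFinP].
Qed.

End smoothing.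

(** * Scaling of candidates, and the minimum along a ray *)

Section candidates.
Context (R : realType) (a b M1 : R) (r m : nat).
Local Open Scope ereal_scope.

Lemma product_component_ge0 (e : r.-tuple R -> R) :
  product_component a b e -> forall x, (0 <= e x)%R.
Proof.
move=> [theta [ek [theta0 ekP eE]]] x; rewrite eE.
apply: mulr_ge0; first exact: ltW.
apply: prodr_ge0 => k _; have [_ pos zero] := ekP k.
by have [/pos/ltW|/zero ->] := pselect (a <= tnth x k <= b)%R.
Qed.

Lemma measurable_product_component (e : r.-tuple R -> R) :
  product_component a b e -> measurable_fun setT e.
Proof.
move=> [theta [ek [theta0 ekP eE]]]; rewrite (funext eE).
apply: measurable_funM => //; apply: measurable_prod => k _.
have [/measurable_int/measurable_EFinP mk _ _] := ekP k.
exact: (measurableT_comp mk (measurable_tnth k)).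
Qed.

(** [theta] absorbs [c], and [normalized] is unchanged because [c] cancels between the function and
    its integral. *)
Lemma candidateZ (c : R) (e : 'I_m -> r.-tuple R -> R) : (0 < c)%R ->
  candidate a b M1 e -> candidate a b M1 (fun j x => c * e j x)%R.
Proof.
move=> c0 + j => /(_ j)[ej ej_ge]; split.
  move: ej => [theta [ek [theta0 ekP eE]]].
  exists (c * theta)%R, ek; split=> [|//|x]; first exact: mulr_gt0.
  by rewrite eE mulrA.
move=> x /ej_ge; rewrite /normalized.
under [in X in _ -> X]eq_integral do rewrite EFinM.
rewrite ge0_integralZl//; last 3 first.
- by apply/measurable_EFinP; exact: measurable_product_component.
- by move=> z _; rewrite lee_fin; exact: product_component_ge0.
- by rewrite lee_fin ltW.
by rewrite invepM// EFinM muleACA -EFinM divff ?gt_eqF// mul1e.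
Qed.

Lemma integral_candidateZ (c : R) (e : 'I_m -> r.-tuple R -> R) : (0 < c)%R ->
  candidate a b M1 e ->
  \int[lebesgue_tuple R r]_x (\sum_(j < m) c * e j x)%R%:E =
  c%:E * \int[lebesgue_tuple R r]_x (\sum_(j < m) e j x)%:E.
Proof.
move=> c0 ce; under eq_integral do rewrite -mulr_sumr EFinM.
rewrite ge0_integralZl//.
- apply/measurable_EFinP; apply: measurable_sum => j.
  by have [/measurable_product_component] := ce j.
- move=> x _; rewrite lee_fin sumr_ge0// => j _.
  by have [/product_component_ge0] := ce j.
- by rewrite lee_fin ltW.
Qed.

(* Along the ray c |-> c * e the objective is -ln c + c I up to a constant, with
   I the mass of e, and this has its minimum at c = 1 only if I = 1. *)
Lemma scaling_minimum_mass1 (A I : \bar R) :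
  A + I \is a fin_num -> 0 <= I ->
  (forall c, (0 < c)%R -> A + I <= (A - (ln c)%:E) + c%:E * I) -> I = 1.
Proof.
(* A finite sum has finite summands, so the rest is about real numbers. *)
rewrite fin_numD => /andP[/fineK <- /fineK <-]; move: (fine A) (fine I) => {}A i.
rewrite lee_fin le_eqVlt => /predU1P[<- min|i0].
  (* For mass zero, [c = 2] would give [0 <= - ln 2]. *)
  have := min 2%R (@ltr0Sn R 1); rewrite mule0 adde0 -EFinB -EFinD lee_fin.
  have : (0 < ln 2 :> R)%R by rewrite ln_gt0// ltr1n.
  by move=> ? ?; exfalso; lra.
(* The choice [c = 1/i] gives [i - 1 <= ln i]. The strict bound [1 + x < exp x] at [x = ln i]
   contradicts this unless [ln i = 0], that is [i = 1]. *)
move=> /(_ i^-1%R); rewrite invr_gt0 => /(_ i0).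
rewrite -EFinM mulVf ?gt_eqF// -EFinB -!EFinD lee_fin lnV ?posrE// => le_i.
have [ln0|ln_neq0] := eqVneq (ln i) 0%R.
  by move/eqP: ln0; rewrite ln_eq0// => /eqP ->.
by have := expR_gt1Dx ln_neq0; rewrite lnK ?posrE// => ?; exfalso; lra.
Qed.

End candidates.

(** * Effect of scaling on the two log-likelihood terms *)

Section objectives.
Context (R : realType) (a b M1 : R) (s : R -> R -> R) (r m : nat).
Hypothesis ms : measurable_fun setT
  (fun p : measurableTypeR R * measurableTypeR R => s p.1 p.2).
Hypothesis s0 : forall v u, 0 <= s v u.
Hypothesis s1 : forall z, a <= z <= b ->
  (\int[lebesgue_measure]_u (s u z)%:E = 1)%E.
Context (e : 'I_m -> r.-tuple R -> R).
Hypothesis e_cand : candidate a b M1 e.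
Local Open Scope ereal_scope.

Let mixture (e' : 'I_m -> r.-tuple R -> R) x :=
  \sum_(j < m) nonlin_smooth a b s (e' j) x.

Let mixture_ge0 e' x : 0 <= mixture e' x.
Proof. by apply: sume_ge0 => j _; exact: nonlin_smooth_ge0. Qed.

Let mixtureZ (c : R) x : (0 < c)%R ->
  mixture (fun j u => c * e j u)%R x = c%:E * mixture e x.
Proof.
move=> c0; rewrite ge0_sume_distrr//; last first.
  by move=> j _; exact: nonlin_smooth_ge0.
apply: eq_bigr => j _; have [ej _] := e_cand j.
apply: nonlin_smoothZ => //; first exact: (product_component_ge0 _ _ _ _ _ ej).
exact: measurable_product_component ej.
Qed.

Let measurable_mixture : measurable_fun setT (mixture e).
Proof.
apply: emeasurable_sum => j; apply: measurable_nonlin_smooth => //.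
by have [/measurable_product_component] := e_cand j.
Qed.

(** Scaling adds [- ln c * g] to the integrand, which integrates to [- ln c] because [g] has mass
    one. *)
Lemma log_likelihoodZ (g : r.-tuple R -> R) (c : R) : (0 < c)%R ->
  measurable_fun setT g -> (forall x, 0 <= g x)%R ->
  \int[lebesgue_tuple R r]_x (g x)%:E = 1 ->
  \int[lebesgue_tuple R r]_x ((g x)%:E *
    lne ((g x)%:E / \sum_(j < m) nonlin_smooth a b s (fun u => c * e j u)%R x))
  = \int[lebesgue_tuple R r]_x ((g x)%:E *
      lne ((g x)%:E / \sum_(j < m) nonlin_smooth a b s (e j) x)) - (ln c)%:E.
Proof.
move=> c0 mg g0 g1.
have g_int : (lebesgue_tuple R r).-integrable setT (EFin \o g).
  apply/integrableP; split; first exact/measurable_EFinP.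
  by under eq_integral do rewrite gee0_abs ?lee_fin//; rewrite g1 ltry.
have cg_int : (lebesgue_tuple R r).-integrable setT
    (EFin \o (fun x => - ln c * g x)%R).
  exact: (integrableZl measurableT (- ln c)%R g_int).
have mG : measurable_fun setT
    (fun x => (g x)%:E * ((ln (g x))%:E - lne (mixture e x))).
  apply: emeasurable_funM; first exact/measurable_EFinP.
  apply: emeasurable_funB.
    apply/measurable_EFinP; apply: measurableT_comp mg.
    exact: measurable_ln.
  by apply: measurableT_comp measurable_mixture; exact: measurable_lne.
(* The first summand is integrable, the second only known to be measurable. Splitting the logarithm
   of the quotient is legitimate under the factor [g x], even where [g] or the mixture vanishes. *)
transitivity (\int[lebesgue_tuple R r]_x ((- ln c * g x)%:E +
    (g x)%:E * ((ln (g x))%:E - lne (mixture e x)))).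
  apply: eq_integral => x _.
  rewrite -/(mixture (fun j u => c * e j u)%R x) mule_lne_div// mixtureZ//.
  rewrite lneMl// oppeD ?fin_num_adde_defr// addeCA.
  by rewrite muleDr// ?fin_num_adde_defr// -EFinN -EFinM mulrC.
rewrite (integralD_integrable_measurable _ _ _ _ _ _ cg_int mG).
under [in LHS]eq_integral do rewrite EFinM.
rewrite (integralZl measurableT g_int) g1 mule1 addeC EFinN; congr (_ - _).
by apply: eq_integral => x _; rewrite -/(mixture e x) mule_lne_div.
Qed.

(** Each of the [n] logarithms gains [ln c], and so does their average; the shift is finite, so it
    separates even from an infinite sum. *)
Lemma mean_log_likelihoodZ (n : nat) (X : 'I_n -> r.-tuple R) (c : R) :
  (0 < c)%R -> (0 < n)%N ->
  - ((n%:R^-1)%:E * \sum_(i < n) lne (\sum_(j < m)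
      nonlin_smooth a b s (fun u => c * e j u)%R (X i))) =
  - ((n%:R^-1)%:E * \sum_(i < n) lne (\sum_(j < m)
      nonlin_smooth a b s (e j) (X i))) - (ln c)%:E.
Proof.
move=> c0 n0.
under eq_bigr do
  rewrite -/(mixture (fun j u => c * e j u)%R _) mixtureZ// lneMl//.
rewrite big_split/= sumEFin sumr_const card_ord muleDr// ?fin_num_adde_defr//.
rewrite -EFinM -[X in (_ * X)%:E]mulr_natl mulrA mulVf ?pnatr_eq0 -?lt0n//.
by rewrite mul1r addeC fin_num_oppeD.
Qed.

End objectives.

(** * Total mass of minimizers, continuous and discrete *)

Theorem theorem2p1 (R : realType) (a b : R) (r m : nat)
    (h : R) (s : R -> R -> R -> R) (M1 : R -> R) (M2 B : R)
    (g : r.-tuple R -> R) :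
  a < b -> (0 < r)%N -> (0 < m)%N ->
  target_density a b g ->
  (exists e0 : 'I_m -> r.-tuple R -> R,
     (forall j x, 0 <= e0 j x) /\ (forall x, g x = \sum_(j < m) e0 j x)) ->
  smoothing_kernel a b (s h) (M1 h) M2 B ->
  (forall e : 'I_m -> r.-tuple R -> R,
     solution [set e' | candidate a b (M1 h) e']
       (objective a b (s h) g) e ->
     (\int[lebesgue_tuple R r]_x (\sum_(j < m) e j x)%:E = 1)%E) /\
  (forall (n : nat) (X : 'I_n -> r.-tuple R),
     (0 < n)%N -> (forall i, cube a b (X i)) ->
     forall e : 'I_m -> r.-tuple R -> R,
     solution [set e' | candidate a b (M1 h) e']
       (objective_discrete a b (s h) X) e ->
     (\int[lebesgue_tuple R r]_x (\sum_(j < m) e j x)%:E = 1)%E).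
Proof.
move=> _ _ _ [mg g0 g1 _] _ [[s_int s0 _] [[_ s1 _ _] _]].
have ms : measurable_fun setT
    (fun p : measurableTypeR R * measurableTypeR R => s h p.1 p.2).
  by move/measurable_int/measurable_EFinP : s_int.
have mass_ge0 e : candidate a b (M1 h) e ->
    (0 <= \int[lebesgue_tuple R r]_x (\sum_(j < m) e j x)%:E)%E.
  move=> ce; apply: integral_ge0 => x _; rewrite lee_fin sumr_ge0// => j _.
  by have [/product_component_ge0] := ce j.
split=> [e [/= ce l_fin l_min]|n X n0 _ e [/= ce l_fin l_min]].
  (* The ray inequality is minimality tested at [c * e]: the scaling identities, read backwards,
     rebuild the objective there, and [candidateZ] makes the point admissible. *)
  apply: (scaling_minimum_mass1 _ _ _ l_fin (mass_ge0 e ce)) => c c0.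
  rewrite -(log_likelihoodZ _ _ _ _ _ _ _ ms s0 s1 _ ce)//.
  rewrite -(integral_candidateZ _ _ _ _ _ _ _ _ c0 ce).
  exact/l_min/candidateZ.
(* The discrete objective obeys the same scaling law, with the sample mean in place of integration
   against [g]. *)
apply: (scaling_minimum_mass1 _ _ _ l_fin (mass_ge0 e ce)) => c c0.
rewrite -(mean_log_likelihoodZ _ _ _ _ _ _ _ ms s0 s1 _ ce)//.
rewrite -(integral_candidateZ _ _ _ _ _ _ _ _ c0 ce).
exact/l_min/candidateZ.
Qed.
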